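(* The category ${\sf HeytFrm}^+$ is dually equivalent to the category ${\sf ES}^+$.
   Context: ${\sf HeytFrm}^+$: objects are Heyting frames (frames $L$ whose set $K(L)$ of compact elements is a Heyting subalgebra of $L$: contains $0,1$, closed under finite meets, finite joins and the frame implication); morphisms are frame homomorphisms that send compact elements to compact elements and preserve the Heyting implication (of the whole frames). ${\sf ES}^+$: objects are Esakia spaces (compact spaces with a partial order such that $x\not\le y$ implies there is a clopen upset containing $x$ but not $y$, and ${\downarrow}U$ is clopen for each clopen $U$); morphisms are continuous order-preserving maps $f:X\to Y$ with $f^{-1}({\downarrow}\,{\sf cl}\,E)={\downarrow}\,{\sf cl}\,f^{-1}(E)$ for every E-constructible $E\subseteq Y$, where ${\sf cl}$ is closure and E-constructible means a finite union of sets $U\setminus V$ with $U,V$ open upsets.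
   Formalization: Heyting frames are additionally required to be coherent: every element is a join of compact elements. Without this the equivalence fails, as the frame of opens of [0,1], whose compact elements are only 0 and 1, shows. *)

(* Defs.v *)
From HB Require Import structures.
From mathcomp Require Import all_boot all_order.
From mathcomp Require Import boolp classical_sets functions cardinality.
From mathcomp Require Import topology.
Set Implicit Arguments.
Unset Strict Implicit.
Unset Printing Implicit Defensive.
Import Order.TTheory.
Local Open Scope classical_set_scope.
Local Open Scope order_scope.

Record category := Category {
  obj :> Type;
  hom : obj -> obj -> Type;
  idm : forall x, hom x x;
  compm : forall x y z, hom y z -> hom x y -> hom x z;
  comp1m : forall x y (f : hom x y), compm (idm y) f = f;
  compm1 : forall x y (f : hom x y), compm f (idm x) = f;
  compmA : forall x y z t (h : hom z t) (g : hom y z) (f : hom x y),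
    compm h (compm g f) = compm (compm h g) f }.

Definition opposite (C : category) : category :=
  @Category C (fun x y => hom y x) (@idm C) (fun x y z g f => compm f g)
    (fun x y f => compm1 f) (fun x y f => comp1m f)
    (fun x y z t h g f => esym (compmA f g h)).

Record functor (C D : category) := Functor {
  fobj :> C -> D;
  fhom : forall x y, hom x y -> hom (fobj x) (fobj y);
  fhom1 : forall x, fhom (idm x) = idm (fobj x);
  fhomM : forall x y z (g : hom y z) (f : hom x y),
    fhom (compm g f) = compm (fhom g) (fhom f) }.

Section FunctorOperations.
Variables C D E : category.

Definition idF : functor C C :=
  @Functor C C id (fun _ _ f => f) (fun _ => erefl) (fun _ _ _ _ _ => erefl).

Variables (G : functor D E) (F : functor C D).

Lemma compF1 (x : C) : fhom G (fhom F (idm x)) = idm (G (F x)).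
Proof. by rewrite !fhom1. Qed.

Lemma compFM (x y z : C) (g : hom y z) (f : hom x y) :
  fhom G (fhom F (compm g f))
  = compm (fhom G (fhom F g)) (fhom G (fhom F f)).
Proof. by rewrite !fhomM. Qed.

Definition compF : functor C E :=
  @Functor C E (fun x => G (F x)) (fun x y f => fhom G (fhom F f)) compF1 compFM.

End FunctorOperations.

Definition is_iso (C : category) (x y : C) (f : hom x y) : Prop :=
  exists g : hom y x, compm g f = idm x /\ compm f g = idm y.

Definition naturally_isomorphic (C D : category) (F G : functor C D) : Prop :=
  exists eta : forall x : C, hom (F x) (G x),
    (forall (x y : C) (f : hom x y),
       compm (eta y) (fhom F f) = compm (fhom G f) (eta x)) /\
    (forall x : C, is_iso (eta x)).

Definition equivalent_categories (C D : category) : Prop :=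
  exists (F : functor C D) (G : functor D C),
    naturally_isomorphic (compF G F) (idF C) /\
    naturally_isomorphic (compF F G) (idF D).

Definition dually_equivalent (C D : category) : Prop :=
  equivalent_categories (opposite C) D.

Section FrameTheory.
Context {d : Order.disp_t} {L : tbLatticeType d}.
Implicit Types (a b c x : L) (A : set L).

(* Only meaningful when A has a supremum, as every set in a frame does; the
   default value \bot makes the join of the empty set correct. *)
Definition join_of A : L := supremum \bot A.

Definition frame_axiom : Prop :=
  (forall A, supremums A !=set0) /\
  (forall a A, a `&` join_of A = join_of [set a `&` x | x in A]).

Definition frame_impl a b : L := join_of [set x | a `&` x <= b].

Definition compact_elt a : Prop :=
  forall A, a <= join_of A ->
    exists B, [/\ finite_set B, B `<=` A & a <= join_of B].

(* Together with the closure of the compact elements under finite meets, this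
   is coherence of the frame. *)
Definition compactly_generated : Prop :=
  forall a, a = join_of [set x | compact_elt x /\ x <= a].

Definition heyting_subalgebra (K : set L) : Prop :=
  [/\ K \bot, K \top &
      forall a b, K a -> K b ->
        [/\ K (a `&` b), K (a `|` b) & K (frame_impl a b)]].

End FrameTheory.

Record heyting_frame := HeytingFrame {
  hf_disp : Order.disp_t;
  hf_sort :> tbLatticeType hf_disp;
  hf_frame : @frame_axiom hf_disp hf_sort;
  hf_generated : @compactly_generated hf_disp hf_sort;
  hf_compact : heyting_subalgebra [set a : hf_sort | compact_elt a] }.

Definition frame_hom (L M : heyting_frame) (f : L -> M) : Prop :=
  [/\ f \top = \top,
      (forall a b, f (a `&` b) = f a `&` f b) &
      (forall A, f (join_of A) = join_of (f @` A))].

Record heyting_frame_hom (L M : heyting_frame) := HeytingFrameHom {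
  hf_fun :> L -> M;
  hf_fun_frame : frame_hom hf_fun;
  hf_fun_compact : forall a, compact_elt a -> compact_elt (hf_fun a);
  hf_fun_impl : forall a b,
    hf_fun (frame_impl a b) = frame_impl (hf_fun a) (hf_fun b) }.

Lemma heyting_frame_hom_ext (L M : heyting_frame) (f g : heyting_frame_hom L M) :
  f =1 g -> f = g.
Proof.
case: f g => [f f1 f2 f3] [g g1 g2 g3] /= /funext fg.
by subst g; congr HeytingFrameHom; exact: Prop_irrelevance.
Qed.

Section HeytFrmPlus.

Lemma heyting_frame_id_hom (L : heyting_frame) : frame_hom (@id L).
Proof. by split=> // A; rewrite image_id. Qed.

Definition heyting_frame_id (L : heyting_frame) : heyting_frame_hom L L :=
  @HeytingFrameHom L L id (heyting_frame_id_hom L) (fun _ h => h) (fun _ _ => erefl).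

Section Composition.
Variables (L M N : heyting_frame).
Variables (g : heyting_frame_hom M N) (f : heyting_frame_hom L M).

Lemma heyting_frame_comp_hom : frame_hom (g \o f).
Proof.
have [f1 f2 f3] := hf_fun_frame f; have [g1 g2 g3] := hf_fun_frame g.
split=> [|a b|A] /=; first by rewrite f1 g1.
  by rewrite f2 g2.
by rewrite f3 g3 -image_comp.
Qed.

Lemma heyting_frame_comp_compact (a : L) : compact_elt a -> compact_elt ((g \o f) a).
Proof. by move=> ca; do 2!apply: hf_fun_compact. Qed.

Lemma heyting_frame_comp_impl (a b : L) :
  (g \o f) (frame_impl a b) = frame_impl ((g \o f) a) ((g \o f) b).
Proof. by rewrite /= !hf_fun_impl. Qed.

Definition heyting_frame_comp : heyting_frame_hom L N :=
  HeytingFrameHom heyting_frame_comp_hom heyting_frame_comp_compact heyting_frame_comp_impl.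

End Composition.

Definition HeytFrm_plus : category :=
  @Category heyting_frame heyting_frame_hom heyting_frame_id heyting_frame_comp
    (fun x y f => @heyting_frame_hom_ext x y
       (heyting_frame_comp (heyting_frame_id y) f) f (fun _ => erefl))
    (fun x y f => @heyting_frame_hom_ext x y
       (heyting_frame_comp f (heyting_frame_id x)) f (fun _ => erefl))
    (fun x y z t h g f => @heyting_frame_hom_ext x t
       (heyting_frame_comp h (heyting_frame_comp g f))
       (heyting_frame_comp (heyting_frame_comp h g) f) (fun _ => erefl)).

End HeytFrmPlus.

Section OrderedSpaces.
Context {d : Order.disp_t} {X : POrderedTopological.type d}.
Implicit Types (U V E : set X).

Definition upset U : Prop := forall x y : X, x <= y -> U x -> U y.

Definition E_constructible E : Prop :=
  exists (n : nat) (U V : 'I_n -> set X),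
    (forall i, [/\ open (U i), upset (U i), open (V i) & upset (V i)]) /\
    E = \bigcup_(i in [set: 'I_n]) (U i `\` V i)%classic.

Definition esakia_axiom : Prop :=
  [/\ compact [set: X],
      (forall x y : X, ~~ (x <= y) ->
         exists U, [/\ clopen U, upset U, U x & ~ U y]) &
      (forall U, clopen U -> clopen (down U))].

End OrderedSpaces.

Record esakia_space := EsakiaSpace {
  es_disp : Order.disp_t;
  es_sort :> POrderedTopological.type es_disp;
  es_axiom : @esakia_axiom es_disp es_sort }.

Record ES_hom (X Y : esakia_space) := ESHom {
  es_fun :> X -> Y;
  es_fun_continuous : continuous es_fun;
  es_fun_homo : {homo es_fun : x y / x <= y};
  es_fun_down : forall E : set Y, E_constructible E ->
    es_fun @^-1` down (closure E) = down (closure (es_fun @^-1` E)) }.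

Lemma ES_hom_ext (X Y : esakia_space) (f g : ES_hom X Y) : f =1 g -> f = g.
Proof.
case: f g => [f f1 f2 f3] [g g1 g2 g3] /= /funext fg.
by subst g; congr ESHom; exact: Prop_irrelevance.
Qed.

Lemma E_constructible_preimage (X Y : esakia_space) (f : ES_hom X Y)
  (E : set Y) : E_constructible E -> E_constructible (f @^-1` E).
Proof.
move=> [n [U [V [UV ->]]]]; exists n.
exists (fun i => f @^-1` U i), (fun i => f @^-1` V i); split=> [i|].
  have [oU uU oV uV] := UV i; have /continuousP fc := es_fun_continuous (e := f).
  by split; [exact: fc| |exact: fc|]; move=> x y /(es_fun_homo f);
    [exact: uU|exact: uV].
by rewrite preimage_bigcup.
Qed.

Section ESPlus.

Lemma ES_id_continuous (X : esakia_space) : continuous (@id X).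
Proof. by move=> x. Qed.

Definition ES_id (X : esakia_space) : ES_hom X X :=
  @ESHom X X id (@ES_id_continuous X) (fun _ _ h => h) (fun _ _ => erefl).

Section Composition.
Variables (X Y Z : esakia_space) (g : ES_hom Y Z) (f : ES_hom X Y).

Lemma ES_comp_continuous : continuous (g \o f).
Proof.
by move=> x; apply: continuous_comp; exact: es_fun_continuous.
Qed.

Lemma ES_comp_homo : {homo g \o f : x y / x <= y}.
Proof. by move=> x y xy; do 2!apply: es_fun_homo. Qed.

Lemma ES_comp_down (E : set Z) : E_constructible E ->
  (g \o f) @^-1` down (closure E) = down (closure ((g \o f) @^-1` E)).
Proof.
move=> cE; change (f @^-1` (g @^-1` down (closure E))
  = down (closure (f @^-1` (g @^-1` E)))).
by rewrite es_fun_down // es_fun_down //; exact: E_constructible_preimage.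
Qed.

Definition ES_comp : ES_hom X Z := ESHom ES_comp_continuous ES_comp_homo ES_comp_down.

End Composition.

Definition ES_plus : category :=
  @Category esakia_space ES_hom ES_id ES_comp
    (fun x y f => @ES_hom_ext x y
       (ES_comp (ES_id y) f) f (fun _ => erefl))
    (fun x y f => @ES_hom_ext x y
       (ES_comp f (ES_id x)) f (fun _ => erefl))
    (fun x y z t h g f => @ES_hom_ext x t
       (ES_comp h (ES_comp g f))
       (ES_comp (ES_comp h g) f) (fun _ => erefl)).

End ESPlus.

(* Main.v *)
(** The space dual to a frame [L] is the set of its meet-prime elements with the
patch topology, and the frame dual to [X] is the lattice of its open upsets,
whose compact elements are the clopen upsets. The two morphism conditions match
because the implication of open upsets is [~ down (closure (U minus V))]: a
continuous monotone map has a preimage map preserving implications if and only if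
it commutes with [down] of closures of the sets [U minus V], hence of their finite
unions, the E-constructible sets. The unit sends [a] to the primes not above [a];
it is an order isomorphism by the prime ideal theorem and compactness. The
counit identifies [x] with the prime open upset [~ down [set x]]. *)

From HB Require Import structures.
From mathcomp Require Import all_boot all_order.
From mathcomp Require Import boolp classical_sets functions cardinality.
From mathcomp Require Import topology.
Require Import Defs.
Set Implicit Arguments.
Unset Strict Implicit.
Unset Printing Implicit Defensive.
Import Order.TTheory.
Local Open Scope classical_set_scope.
Local Open Scope order_scope.

(** * Joins, compact elements and meet-primes in a frame *)

Section Frames.
Context {d : Order.disp_t} {L : tbLatticeType d}.
Hypothesis frL : @frame_axiom d L.
Implicit Types (a b c x y : L) (A B D : set L).

Lemma join_ofP A b : join_of A <= b <-> ubound A b.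
Proof.
suff : supremums A (join_of A).
  case=> ub lub; split=> [Ab x Ax|]; last exact: lub.
  exact: le_trans (ub _ Ax) Ab.
(* The default [\bot] is the correct join of the empty set; for other sets the frame axiom excludes
   the failure case of [xget]. *)
rewrite /join_of /supremum; case: eqP => [->|_].
  by split=> [x //|x _]; exact: le0x.
by case: xgetP => // none; have [x /none] := frL.1 A.
Qed.

Lemma join_of_ub A a : A a -> a <= join_of A.
Proof. exact: (join_ofP A (join_of A)).1. Qed.

Lemma join_of_le A B : (forall a, A a -> exists2 b, B b & a <= b) ->
  join_of A <= join_of B.
Proof.
move=> AB; apply/join_ofP => a /AB[b Bb] ab.
exact: le_trans ab (join_of_ub Bb).
Qed.

Lemma le_join_eq A b :
  ubound A b -> (forall c, ubound A c -> b <= c) -> b = join_of A.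
Proof.
move=> ub lub; apply/le_anti/andP; split; last exact/join_ofP.
by apply: lub => a; exact: join_of_ub.
Qed.

(** Residuation is where the infinite distributive law enters: meeting with [a] distributes over the
    join that defines the implication. *)
Lemma frame_implP a b c : c <= frame_impl a b <-> a `&` c <= b.
Proof.
split=> [ci|acb]; last exact: join_of_ub.
apply: le_trans (leI2 (lexx a) ci) _; rewrite frL.2.
by apply/join_ofP => _ [x /= axb <-].
Qed.

Lemma compact_elt0 : compact_elt (\bot : L).
Proof. by move=> A _; exists set0; split; rewrite ?le0x. Qed.

Lemma compact_eltU a b : compact_elt a -> compact_elt b -> compact_elt (a `|` b).
Proof.
move=> ca cb A; rewrite leUx => /andP[/ca[B [fB BA aB]] /cb[C [fC CA bC]]].
exists (B `|` C)%classic; split; first by rewrite finite_setU.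
  by move=> x [/BA|/CA].
rewrite leUx; apply/andP; split.
  by apply: le_trans aB (join_of_le _) => x Bx; exists x => //; left.
by apply: le_trans bC (join_of_le _) => x Cx; exists x => //; right.
Qed.

(** Serves to treat the finite subsets supplied by compactness through [\bot] and binary joins
    alone. *)
Lemma finite_join_of_ind (P : L -> Prop) B :
  P \bot -> (forall a b, P a -> P b -> P (a `|` b)) ->
  finite_set B -> (forall b, B b -> P b) -> P (join_of B).
Proof.
move=> P0 PU /finite_seqP[s ->]; elim: s => [|x s IHs] sP.
  suff <- : \bot = join_of [set` Nil L] by [].
  by apply: le_join_eq => // c _; exact: le0x.
suff <- : x `|` join_of [set` s] = join_of [set` x :: s].
  apply: PU; first by apply: sP; rewrite /= mem_head.
  by apply: IHs => b bs; apply: sP; rewrite /= inE bs orbT.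
apply: le_join_eq => [b|c].
  rewrite /= inE => /orP[/eqP->|bs]; first exact: leUl.
  exact: le_trans (join_of_ub bs) (leUr _ _).
move=> xsc; rewrite leUx xsc ?(mem_head, inE) //=; last by rewrite mem_head.
by apply/join_ofP => b bs; apply: xsc; rewrite /= inE bs orbT.
Qed.

Lemma meetUle a b c x :
  a `&` c <= x -> b `&` c <= x -> (a `|` b) `&` c <= x.
Proof.
rewrite ![_ `&` c]meetC => cax cbx; rewrite -frame_implP leUx.
by apply/andP; split; exact/frame_implP.
Qed.

Definition meet_prime x := x != \top /\
  forall a b, a `&` b <= x -> a <= x \/ b <= x.

(** In the Zorn argument below, this replaces a finite subset of a chain by a single member of the
    chain. *)
Lemma finite_chain_ub A B : total_on A (fun x y => x <= y) -> A !=set0 ->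
  finite_set B -> B `<=` A -> exists2 a, A a & ubound B a.
Proof.
move=> chA [a0 Aa0] /finite_seqP[s ->]; elim: s => [|x s IHs] sA.
  by exists a0.
have [|a Aa sa] := IHs; first by move=> y ys; apply: sA; rewrite /= inE ys orbT.
have Ax : A x by apply: sA; rewrite /= mem_head.
have [xa|ax] := chA _ _ Ax Aa.
  by exists a => // y; rewrite /= inE => /orP[/eqP->|/sa].
exists x => // y; rewrite /= inE => /orP[/eqP->//|/sa ya].
exact: le_trans ya ax.
Qed.

(* The prime ideal theorem, in a form covering both spatiality and the
   description of [down] of a basic clopen: the chosen [p] is maximal among the
   elements above [b] that are above no member of [D]. *)
Lemma meet_prime_above D b : D !=set0 ->
  (forall c, D c -> compact_elt c) ->
  (forall c e, D c -> D e -> D (c `&` e)) ->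
  (forall c, D c -> ~~ (c <= b)) ->
  exists p, [/\ meet_prime p, b <= p & forall c, D c -> ~~ (c <= p)].
Proof.
move=> [c0 Dc0] Dk DI Db.
pose P x := b <= x /\ forall c, D c -> ~~ (c <= x).
pose T := {x | P x}.
have bP : P b by [].
pose R (s t : T) : bool := sval s <= sval t.
have [||||[p [bp Dp]] pmax] := @Zorn T R.
- by move=> t; exact: lexx.
- by move=> r s t; exact: le_trans.
- case=> x Px [y Py] xy yx; apply: eq_exist.
  by apply/le_anti; rewrite [x <= y]xy.
- move=> A chA; have [[s0 As0]|A0] := pselect (A !=set0); last first.
    by exists (exist _ b bP) => s As; case: A0; exists s.
  pose B := [set sval s | s in A].
  have Bs0 : B (sval s0) by exists s0.
  have chB : total_on B (fun x y => x <= y).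
    by move=> _ _ [s As <-] [t At <-]; exact: chA.
  have PB : P (join_of B).
    split; first exact: le_trans (svalP s0).1 (join_of_ub Bs0).
    (* Compactness of [c] keeps the join of the chain in [P]: otherwise [c] would already lie below
       one member. *)
    move=> c Dc; apply/negP => /(Dk c Dc)[F [fF FB cF]].
    have [_ [s As <-] Fs] := finite_chain_ub chB (ex_intro _ _ Bs0) fF FB.
    have /negP := (svalP s).2 c Dc; apply.
    by apply: le_trans cF _; exact/join_ofP.
  by exists (exist _ _ PB) => s As; apply: join_of_ub; exists s.
(* By maximality, a proper enlargement of [p] must leave [P], which can only happen through a member
   of [D]. *)
have maxp x : ~~ (x <= p) -> exists2 c, D c & c <= x `|` p.
  move=> xp; apply: contrapT => none.
  have Px : P (x `|` p).
    split; first exact: le_trans bp (leUr _ _).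
    by move=> c Dc; apply/negP => cxp; apply: none; exists c.
  have := pmax (exist _ _ Px) (leUr _ _) => /(congr1 sval) /= xpE.
  by move: xp; rewrite -xpE leUl.
exists p; split=> //; split=> [|x y xyp].
  by apply/eqP => pT; have := Dp _ Dc0; rewrite pT lex1.
(* By distributivity the meet of [c] and [e], again in [D], lies below the join of [p] with the meet
   of [x] and [y], which is [p]. *)
apply: contrapT => /not_orP[/negP /maxp[c Dc cx] /negP /maxp[e De ey]].
have /negP := Dp _ (DI _ _ Dc De); apply.
apply: le_trans (_ : (x `|` p) `&` (y `|` p) <= _); first exact: leI2.
apply: meetUle; last exact: leIl.
by rewrite meetC; apply: meetUle; [rewrite meetC|exact: leIl].
Qed.

End Frames.

(** * Meet-prime elements with the patch topology *)

Section Points.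
Variable L : heyting_frame.
Implicit Types (a b c : L).

Record point := Point { point_elt : L; point_prime : meet_prime point_elt }.

HB.instance Definition _ := gen_eqMixin point.
HB.instance Definition _ := gen_choiceMixin point.

Implicit Types p q : point.

Lemma point_inj p q : point_elt p = point_elt q -> p = q.
Proof.
case: p q => [x px] [y py] /= xy; subst y.
by congr Point; exact: Prop_irrelevance.
Qed.

(* A point is encoded by the largest element outside the corresponding
   completely prime filter, so inclusion of filters reverses the order. *)
Definition point_le p q : bool := point_elt q <= point_elt p.

Fact point_le_refl : reflexive point_le.
Proof. by move=> p; exact: lexx. Qed.

Fact point_le_anti : antisymmetric point_le.
Proof. by move=> p q /andP[pq qp]; apply/point_inj/le_anti/andP; split. Qed.

Fact point_le_trans : transitive point_le.
Proof. by move=> q p r pq qr; exact: le_trans qr pq. Qed.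

Fact point_display : Order.disp_t. Proof. exact. Qed.

HB.instance Definition _ := Order.Le_isPOrder.Build point_display point
  point_le_refl point_le_anti point_le_trans.

(** In terms of completely prime filters, these are the filters that contain [a]. *)
Definition opens a : set point := [set p | ~~ (a <= point_elt p)].

(** Compact elements are closed under finite meets and joins, so these differences form a basis of
    the patch topology and not merely a subbasis. *)
Definition patch_open (O : set point) : Prop := forall p, O p ->
  exists a b, [/\ compact_elt a, compact_elt b,
    (opens a `\` opens b)%classic p & (opens a `\` opens b)%classic `<=` O].

Lemma opens0 : opens \bot = set0.
Proof. by apply/seteqP; split=> // p; rewrite /opens /= le0x. Qed.

Lemma opens1 : opens \top = setT.
Proof.
apply/seteqP; split=> // p _; rewrite /opens /= le1x.
by have [] := point_prime p.
Qed.

Lemma opensI a b : opens (a `&` b) = (opens a `&` opens b)%classic.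
Proof.
apply/seteqP; split=> p; rewrite /opens /=.
  move=> ab; split; apply: contra ab => ap; apply: le_trans ap.
    exact: leIl.
  exact: leIr.
move=> [/negP ap /negP bp]; apply/negP.
by move=> /(point_prime p).2[].
Qed.

Lemma opensU a b : opens (a `|` b) = (opens a `|` opens b)%classic.
Proof.
apply/seteqP; split=> p; rewrite /opens /= leUx negb_and; first by move/orP.
by move=> ab; apply/orP.
Qed.

Lemma opens_join_of (A : set L) : opens (join_of A) = \bigcup_(a in A) opens a.
Proof.
apply/seteqP; split=> p; rewrite /opens /=.
  move=> /negP Ap; apply: contrapT => none; apply: Ap.
  apply/(join_ofP (@hf_frame L)) => a Aa; apply: contrapT => /negP ap.
  by apply: none; exists a.
move=> [a Aa]; apply: contra; apply: le_trans.
exact: (join_of_ub (@hf_frame L)).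
Qed.

Lemma compact_elt1 : compact_elt (\top : L).
Proof. by have [] := hf_compact L. Qed.

Lemma compact_eltI a b : compact_elt a -> compact_elt b -> compact_elt (a `&` b).
Proof. by have [_ _ K] := hf_compact L => ka kb; have [] := K _ _ ka kb. Qed.

Lemma compact_impl a b :
  compact_elt a -> compact_elt b -> compact_elt (frame_impl a b).
Proof. by have [_ _ K] := hf_compact L => ka kb; have [] := K _ _ ka kb. Qed.

Fact patch_openT : patch_open setT.
Proof.
move=> p _; exists \top, \bot; split=> //.
- exact: compact_elt1.
- exact: compact_elt0.
- by rewrite opens1 opens0; split.
Qed.

Fact patch_openI : setI_closed patch_open.
Proof.
move=> O O' oO oO' p [/oO[a [b [ka kb [ap bp] abO]]]].
move=> /oO'[c [e [kc ke [cp ep] ceO]]].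
exists (a `&` c), (b `|` e); split.
- exact: compact_eltI.
- exact: (compact_eltU (@hf_frame L)).
- by rewrite opensI opensU; split=> // -[].
- rewrite opensI opensU => q [[aq cq] /not_orP[bq eq]].
  by split; [exact: abO|exact: ceO].
Qed.

Fact patch_open_bigcup (I : Type) (f : I -> set point) :
  (forall i, patch_open (f i)) -> patch_open (\bigcup_i f i).
Proof.
move=> of_ p [i _ /of_[a [b [ka kb abp abf]]]].
by exists a, b; split=> // q /abf; exists i.
Qed.

HB.instance Definition _ := isOpenTopological.Build point
  patch_openT patch_openI patch_open_bigcup.

Lemma open_patch (O : set point) : open O <-> patch_open O.
Proof. by []. Qed.

Lemma open_opensD a b : compact_elt a -> compact_elt b ->
  open (opens a `\` opens b)%classic.
Proof.
move=> ka kb; apply/open_patch => p abp.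
by exists a, b; split=> //; exact: subset_refl.
Qed.

Lemma not_le_compact a b : ~~ (a <= b) ->
  exists c, [/\ compact_elt c, c <= a & ~~ (c <= b)].
Proof.
move=> /negP ab; apply: contrapT => none; apply: ab.
rewrite (hf_generated a); apply/(join_ofP (@hf_frame L)) => c [kc ca].
by apply: contrapT => /negP cb; apply: none; exists c.
Qed.

(** This is spatiality: if [a <= b] fails, some compact element below [a] is not below [b], and
    [meet_prime_above] with a singleton [D] gives a prime separating the two. *)
Lemma opens_sub a b : opens a `<=` opens b <-> a <= b.
Proof.
split=> [ab|ab p]; last by apply: contra; exact: le_trans.
apply: contrapT => /negP /not_le_compact[c [kc ca cb]].
have [||||p [pp bp cp]] := meet_prime_above (@hf_frame L) (D := [set c]) (b := b).
- by exists c.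
- by move=> _ ->.
- by move=> _ _ -> ->; exact: meetxx.
- by move=> _ ->.
have : opens a (Point pp) by apply: contra (cp c erefl); exact: le_trans.
by move=> /ab /negP.
Qed.

Lemma opens_inj : injective opens.
Proof.
by move=> a b ab; apply/le_anti/andP; split; apply/opens_sub; rewrite ab.
Qed.

Lemma opens_compact a :
  opens a = \bigcup_(c in [set c | compact_elt c /\ c <= a]) opens c.
Proof. by rewrite -opens_join_of -hf_generated. Qed.

Lemma open_opens a : open (opens a).
Proof.
rewrite opens_compact; apply: bigcup_open => c [kc _].
rewrite -[opens c]setD0 -opens0; apply: open_opensD => //.
exact: compact_elt0.
Qed.

Lemma closed_opens a : compact_elt a -> closed (opens a).
Proof.
move=> ka; rewrite -openC -setTD -opens1; apply: open_opensD => //.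
exact: compact_elt1.
Qed.

Lemma upset_opens a : upset (opens a).
Proof. by move=> p q pq; apply: contra => aq; exact: le_trans aq pq. Qed.

(** The limit of an ultrafilter [F] is the join of the compact [c] with [opens c] not in [F]. These
    [c] form an ideal of compact elements, so a compact element below the join belongs to it;
    primeness of the join then comes from [F] being closed under intersection. *)
Lemma compact_points : compact [set: point].
Proof.
rewrite compact_ultra => F UF _.
have FP : ProperFilter F by exact: ultra_proper.
pose D := [set c : L | compact_elt c /\ ~ F (opens c)].
have FD c : compact_elt c -> F (opens c) <-> ~~ (c <= join_of D).
  move=> kc; split=> [Fc|]; last first.
    move/negP => cD; apply: contrapT => Fc; apply: cD.
    exact: (join_of_ub (@hf_frame L)).
  apply/negP => /kc[B [fB BD cB]].
  suff [_] : D (join_of B) by apply; apply: filterS Fc; exact/opens_sub.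
  apply: (finite_join_of_ind (@hf_frame L)) => //.
    split; first exact: compact_elt0.
    by rewrite opens0; exact: filter_not_empty.
  move=> a b [ka Fa] [kb Fb]; split; first exact: (compact_eltU (@hf_frame L)).
  rewrite opensU => Fab.
  have [//|Fa'] := in_ultra_setVsetC (opens a) UF.
  have [//|Fb'] := in_ultra_setVsetC (opens b) UF.
  apply: (@filter_not_empty _ F).
  by apply: filterS (filterI Fab (filterI Fa' Fb')) => p [[ap|bp] [nap nbp]].
have pD : meet_prime (join_of D).
  split=> [|a b abD].
    apply/eqP => DT; have := (FD _ compact_elt1).1.
    by rewrite DT lex1 opens1 => /(_ filterT).
  apply: contrapT => /not_orP[/negP /not_le_compact[c [kc ca cD]]].
  move=> /negP /not_le_compact[e [ke eb eD]].
  have Fce : F (opens (c `&` e)) by rewrite opensI; apply: filterI; exact/FD.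
  have /negP := (FD _ (compact_eltI kc ke)).1 Fce; apply.
  by apply: le_trans abD; exact: leI2.
exists (Point pD); split=> //= O; rewrite nbhsE => -[O' [oO' O'D] O'O].
apply: filterS O'O _; have [a [b [ka kb [aD bD] abO']]] := (open_patch _).1 oO' _ O'D.
apply: filterS abO' _; apply: filterI; first exact/FD.
by have [/(FD _ kb)|] := in_ultra_setVsetC (opens b) UF.
Qed.

End Points.

(** If every member of [WW] met [C], the traces on [C] would generate a proper filter, and a cluster
    point of it in [C] would lie in every member. *)
Lemma compact_avoid (T : topologicalType) (C : set T) (WW : set (set T)) :
  compact C -> WW setT -> (forall W, WW W -> closed W) ->
  (forall W W', WW W -> WW W' -> WW (W `&` W')%classic) ->
  (forall y, C y -> exists2 W, WW W & ~ W y) ->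
  exists2 W, WW W & W `<=` (~` C)%classic.
Proof.
move=> cC WT Wcl WI CW; apply: contrapT => none.
have FF : ProperFilter (filter_from WW (fun W => W `&` C)%classic).
  apply: filter_from_proper.
    apply: filter_from_filter; first by exists setT.
    move=> W W' wW wW'; exists (W `&` W')%classic; first exact: WI.
    by move=> x [[? ?] ?].
  move=> W wW; apply: contrapT => WC; apply: none; exists W => // x Wx Cx.
  by apply: WC; exists x.
have [|y [Cy yF]] := cC _ FF; first by exists setT => // x [].
have [W wW nWy] := CW _ Cy.
have WF : filter_from WW (fun W => W `&` C)%classic (W `&` C)%classic by exists W.
have Wn : nbhs y (~` W)%classic.
  by apply: open_nbhs_nbhs; split=> //; rewrite openC; exact: Wcl.
by have [x [[Wx _] nWx]] := yF _ _ WF Wn.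
Qed.

(** * Separation by clopen upsets in Priestley spaces *)

Section Priestley.
Context {d : Order.disp_t} {X : POrderedTopological.type d}.
Hypothesis cX : compact [set: X].
Hypothesis sepX : forall x y : X, ~~ (x <= y) ->
  exists U, [/\ clopen U, upset U, U x & ~ U y].
Implicit Types (x y z : X) (U V W C : set X).

Lemma upset_notin U x y : upset U -> U x -> ~ U y -> ~~ (x <= y).
Proof. by move=> uU Ux nUy; apply/negP => /uU /(_ Ux). Qed.

Lemma upsetC_down U : upset (~` down U)%classic.
Proof.
move=> x y xy nx [z [Uz yz]]; apply: nx; exists z; split=> //.
exact: le_trans yz.
Qed.

Lemma closed_compact C : closed C -> compact C.
Proof. by move=> clC; apply: subclosed_compact clC cX _. Qed.

Lemma upsetI U V : upset U -> upset V -> upset (U `&` V)%classic.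
Proof. by move=> uU uV x y xy [Ux Vx]; split; [exact: uU Ux|exact: uV Vx]. Qed.

(** The clopen upsets containing [z] are closed under intersection, and the separation axiom
    excludes each point of [C] by one of them. *)
Lemma clopen_upset_avoid C z : closed C -> (forall y, C y -> ~~ (z <= y)) ->
  exists W, [/\ clopen W, upset W, W z & W `<=` (~` C)%classic].
Proof.
move=> clC zC.
have [||||y Cy|W [cW uW Wz] WC] := @compact_avoid X C
  [set W | [/\ clopen W, upset W & W z]].
- exact: closed_compact.
- by split=> //; exact: clopenT.
- by move=> W [[]].
- move=> W W' [cW uW Wz] [cW' uW' Wz']; split=> //; first exact: clopenI.
  exact: upsetI.
- by have [U [cU uU Uz nUy]] := sepX (zC _ Cy); exists U.
- by exists W.
Qed.

Lemma open_upset_nbhs U z : open U -> upset U -> U z ->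
  exists W, [/\ clopen W, upset W, W z & W `<=` U].
Proof.
move=> oU uU Uz; have [|y nUy|W [cW uW Wz WU]] := @clopen_upset_avoid (~` U) z.
- by rewrite closedC.
- exact: upset_notin uU Uz nUy.
- by exists W; split=> // x /WU; rewrite setCK.
Qed.

Lemma closed_down C : closed C -> closed (down C).
Proof.
move=> clC; rewrite -openC openE => z nz.
have [y Cy|W [[oW _] uW Wz WC]] := @clopen_upset_avoid C z clC.
  by apply/negP => zy; apply: nz; exists y.
rewrite /interior nbhsE; exists W => // x Wx [y [Cy xy]].
exact: WC (uW _ _ xy Wx) Cy.
Qed.

Lemma priestley_hausdorff : hausdorff_space X.
Proof.
have sep x y : ~~ (x <= y) -> ~ cluster (nbhs x) y.
  move=> /sepX[U [[oU clU] _ Ux nUy]] /(_ U (~` U)%classic).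
  case=> [||z []//]; apply: open_nbhs_nbhs; split=> //.
  by rewrite openC.
move=> x y xy; apply/le_anti; apply/andP; split; apply: contrapT => /negP /sep.
  by apply.
by apply=> A B /xy Ax /Ax; rewrite setIC.
Qed.

End Priestley.

(** * The Heyting frame of open upsets *)

Section OpenUpsets.
Variable X : esakia_space.
Implicit Types (x y z : X).

Record open_upset := OpenUpset {
  upset_set :> set X;
  upset_open : open upset_set;
  upset_upset : upset upset_set }.

HB.instance Definition _ := gen_eqMixin open_upset.
HB.instance Definition _ := gen_choiceMixin open_upset.

Implicit Types U V W : open_upset.

Lemma open_upset_inj U V : upset_set U = upset_set V -> U = V.
Proof.
case: U V => [U oU uU] [V oV uV] /= UV; subst V.
by congr OpenUpset; exact: Prop_irrelevance.
Qed.

Definition open_upset_le U V : bool := `[< U `<=` V >].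

Fact open_upset_le_refl : reflexive open_upset_le.
Proof. by move=> U; apply/asboolP. Qed.

Fact open_upset_le_anti : antisymmetric open_upset_le.
Proof.
move=> U V /andP[/asboolP UV /asboolP VU].
by apply/open_upset_inj/seteqP; split.
Qed.

Fact open_upset_le_trans : transitive open_upset_le.
Proof.
move=> V U W /asboolP UV /asboolP VW; apply/asboolP.
exact: subset_trans UV VW.
Qed.

Fact open_upset_display : Order.disp_t. Proof. exact. Qed.

HB.instance Definition _ := Order.Le_isPOrder.Build open_upset_display open_upset
  open_upset_le_refl open_upset_le_anti open_upset_le_trans.

Lemma open_upset_leP U V : reflect (U `<=` V) (U <= V).
Proof. exact: asboolP. Qed.

Fact open_upset_meet_subproof U V : open (U `&` V)%classic /\ upset (U `&` V)%classic.
Proof.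
split; first by apply: openI; exact: upset_open.
by move=> x y xy [Ux Vx]; split; exact: upset_upset xy _.
Qed.

Definition open_upset_meet U V :=
  OpenUpset (open_upset_meet_subproof U V).1 (open_upset_meet_subproof U V).2.

Fact open_upset_join_subproof U V : open (U `|` V)%classic /\ upset (U `|` V)%classic.
Proof.
split; first by apply: openU; exact: upset_open.
by move=> x y xy [Ux|Vx]; [left|right]; exact: upset_upset xy _.
Qed.

Definition open_upset_join U V :=
  OpenUpset (open_upset_join_subproof U V).1 (open_upset_join_subproof U V).2.

Fact open_upset_meetP U V W :
  (U <= open_upset_meet V W) = (U <= V) && (U <= W).
Proof.
apply/open_upset_leP/andP => [UVW|[/open_upset_leP UV /open_upset_leP UW]].
  by split; apply/open_upset_leP => x /UVW[].
by move=> x Ux; split; [exact: UV|exact: UW].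
Qed.

Fact open_upset_joinP U V W :
  (open_upset_join U V <= W) = (U <= W) && (V <= W).
Proof.
apply/open_upset_leP/andP => [UVW|[/open_upset_leP UW /open_upset_leP VW]].
  by split; apply/open_upset_leP => x Ux; apply: UVW; [left|right].
by move=> x [/UW|/VW].
Qed.

HB.instance Definition _ := Order.POrder_MeetJoin_isLattice.Build
  open_upset_display open_upset open_upset_meetP open_upset_joinP.

Definition open_upset_bottom := @OpenUpset set0 open0 (fun _ _ _ h => h).
Definition open_upset_top := @OpenUpset setT openT (fun _ _ _ h => h).

Fact open_upset_le0 U : open_upset_bottom <= U.
Proof. exact/open_upset_leP. Qed.

Fact open_upset_le1 U : U <= open_upset_top.
Proof. exact/open_upset_leP. Qed.

HB.instance Definition _ := Order.hasBottom.Build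
  open_upset_display open_upset open_upset_le0.
HB.instance Definition _ := Order.hasTop.Build
  open_upset_display open_upset open_upset_le1.

Fact open_upset_bigcup_subproof (A : set open_upset) :
  open (\bigcup_(U in A) upset_set U) /\ upset (\bigcup_(U in A) upset_set U).
Proof.
split; first by apply: bigcup_open => U _; exact: upset_open.
by move=> x y xy [U AU Ux]; exists U => //; exact: upset_upset xy _.
Qed.

Definition open_upset_bigcup (A : set open_upset) := OpenUpset
  (open_upset_bigcup_subproof A).1 (open_upset_bigcup_subproof A).2.

Lemma open_upset_supremum (A : set open_upset) : supremums A (open_upset_bigcup A).
Proof.
split=> [U AU|U AU]; apply/open_upset_leP => x.
  by move=> Ux; exists U.
by move=> [V /AU/open_upset_leP]; apply.
Qed.

Lemma open_upset_join_of (A : set open_upset) :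
  join_of A = open_upset_bigcup A.
Proof.
have AS := open_upset_supremum A.
rewrite /join_of /supremum; case: eqP => [A0|_].
  apply: open_upset_inj; apply/seteqP; split=> // x [U].
  by rewrite A0.
case: xgetP => [U _ AU|none]; first exact: is_subset1_supremums AU AS.
by have := none _ AS.
Qed.

Lemma open_upset_frame : @frame_axiom _ open_upset.
Proof.
split=> [A|U A]; first by exists (open_upset_bigcup A); exact: open_upset_supremum.
rewrite !open_upset_join_of; apply: open_upset_inj; apply/seteqP.
split=> x /= [].
  by move=> Ux [V AV Vx]; exists (U `&` V)%O => //; exists V.
by move=> _ [V AV <-] [Ux Vx]; split=> //; exists V.
Qed.

(** An open upset avoiding the difference also avoids its closure, and hence everything below the
    closure. Conversely the right-hand side is itself an open upset, since down-sets of closed sets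
    are closed. *)
Lemma open_upset_impl U V :
  upset_set (frame_impl U V) = (~` down (closure (U `\` V)))%classic.
Proof.
have [cX sepX _] := es_axiom X.
rewrite /frame_impl open_upset_join_of; apply/seteqP; split=> x /=.
  move=> [W /open_upset_leP UWV Wx] [y [cly xy]].
  have Wy := upset_upset xy Wx.
  have [z [[Uz nVz] Wz]] := cly W (open_nbhs_nbhs (conj (upset_open W) Wy)).
  by apply: nVz; apply: UWV.
move=> nx.
have oD : open (~` down (closure (U `\` V)))%classic.
  by rewrite openC; apply: closed_down => //; exact: closed_closure.
exists (OpenUpset oD (@upsetC_down _ _ _)) => //.
apply/open_upset_leP => y [Uy ny]; apply: contrapT => nVy; apply: ny.
by exists y; split=> //; exact: subset_closure.
Qed.

Lemma clopen_compact_elt U : closed U -> compact_elt U.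
Proof.
have [cX _ _] := es_axiom X.
move=> clU A; rewrite open_upset_join_of => /open_upset_leP UA.
(* The family consists of the complements of finite unions from [A]; a member disjoint from [U] is a
   finite subcover. *)
have [||||y Uy|W [B [[fB BA] WB]] WU] := @compact_avoid X U
  [set W | exists B, (finite_set B /\ B `<=` A) /\
     W = (~` \bigcup_(V in B) upset_set V)%classic].
- exact: closed_compact.
- by exists set0; rewrite bigcup_set0 setC0; split=> //; split=> //; exact: finite_set0.
- by move=> _ [B [_ ->]]; rewrite closedC; apply: bigcup_open => V _; exact: upset_open.
- move=> _ _ [B [[fB BA] ->]] [B' [[fB' B'A] ->]]; exists (B `|` B')%classic.
  split; last by rewrite bigcup_setU setCU.
  by rewrite finite_setU; split=> // V [/BA|/B'A].
- have [V AV Vy] := UA _ Uy; exists (~` V)%classic; last exact.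
  by exists [set V]; rewrite bigcup_set1; split=> //; split=> // _ ->.
exists B; split=> //; rewrite open_upset_join_of; apply/open_upset_leP => x Ux.
by apply: contrapT => nBx; apply: WU Ux; rewrite WB.
Qed.

Lemma open_upset_clopen U :
  U = join_of [set W : open_upset | closed W /\ W <= U].
Proof.
have [cX sepX _] := es_axiom X.
apply: open_upset_inj; rewrite open_upset_join_of; apply/seteqP; split=> x.
  move=> Ux; have [W [[oW clW] uW Wx WU]] :=
    open_upset_nbhs cX sepX (upset_open U) (@upset_upset U) Ux.
  by exists (OpenUpset oW uW) => //; split=> //; exact/open_upset_leP.
by move=> [W [_ /open_upset_leP WU] /WU].
Qed.

(** As [U] is already open, closed means clopen here. A compact [U] is a join of finitely many
    clopen upsets, and finite unions of closed sets are closed. *)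
Lemma compact_elt_clopen U : compact_elt U <-> closed U.
Proof.
split=> [kU|]; last exact: clopen_compact_elt.
have [|B [fB BU UB]] := kU [set W : open_upset | closed W /\ W <= U].
  by rewrite -open_upset_clopen.
have -> : U = join_of B.
  apply/le_anti; rewrite UB; apply/(join_ofP open_upset_frame) => W /BU[].
  by [].
apply: (finite_join_of_ind open_upset_frame (P := fun U : open_upset => closed U)) => //.
- exact: closed0.
- by move=> V W; exact: closedU.
- by move=> W /BU[].
Qed.

Lemma open_upset_generated : @compactly_generated _ open_upset.
Proof.
move=> U; rewrite {1}[U]open_upset_clopen; congr join_of.
by apply/seteqP; split=> W [/compact_elt_clopen kW WU].
Qed.

Lemma open_upset_heyting : @heyting_subalgebra _ open_upset [set U | compact_elt U].
Proof.
have [_ _ dX] := es_axiom X.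
split=> /=; try exact/compact_elt_clopen/closedT.
  exact/compact_elt_clopen/closed0.
move=> U V /compact_elt_clopen clU /compact_elt_clopen clV.
split; apply/compact_elt_clopen; first exact: closedI.
  exact: closedU.
(* For clopen upsets the closure in the implication formula disappears, and the Esakia axiom makes
   the down-set clopen. *)
have cUV : clopen (U `\` V)%classic.
  apply: clopenI; first by split=> //; exact: upset_open.
  by apply: (@clopenC X V setT); split=> //; exact: upset_open.
rewrite open_upset_impl -(closure_id _).1; last exact: cUV.2.
by rewrite closedC; exact: (dX _ cUV).1.
Qed.

Definition upset_frame : heyting_frame :=
  HeytingFrame open_upset_frame open_upset_generated open_upset_heyting.

End OpenUpsets.

(** * The Esakia space of points and its open upsets *)

Section PointSpace.
Variable L : heyting_frame.
Implicit Types (a b c : L) (p q : point L).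

Lemma points_sep p q : ~~ (p <= q) ->
  exists U, [/\ clopen U, upset U, U p & ~ U q].
Proof.
move=> /not_le_compact[c [kc cq cp]]; exists (opens c); split=> //.
- by split; [exact: open_opens|exact: closed_opens].
- exact: upset_opens.
- by move/negP.
Qed.

(** Provides the Esakia condition for points. One inclusion is modus ponens inside a prime; the
    other has to construct a prime below [point_elt p], because the order on points is reversed. *)
Lemma down_opensD a b : compact_elt a ->
  down (opens a `\` opens b)%classic = (~` opens (frame_impl a b))%classic.
Proof.
move=> ka; have frL := @hf_frame L; apply/seteqP; split=> p.
  move=> [q [[aq /negP/negPn bq] qp]] /negP; apply.
  apply: le_trans (qp : point_elt q <= point_elt p).
  have : a `&` frame_impl a b <= point_elt q.
    by apply: le_trans bq; exact/frame_implP.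
  by case/(point_prime q).2 => // aq'; case/negP: aq.
move=> /negP/negPn abp.
(* A prime above no member of [D] is not above [a], and by compact generation it lies below
   [point_elt p]. A member of [D] below [b] would give, by residuation, some
   [c <= frame_impl a b <= point_elt p]. *)
pose D := [set c `&` a | c in [set c | compact_elt c /\ ~~ (c <= point_elt p)]].
have [||||x [px bx Dx]] := meet_prime_above frL (D := D) (b := b).
- exists (\top `&` a), \top => //; split; first exact: compact_elt1.
  by rewrite le1x; have [] := point_prime p.
- by move=> _ [c [kc _] <-]; exact: compact_eltI.
- move=> _ _ [c [kc cp] <-] [e [ke ep] <-]; exists (c `&` e).
    split; first exact: compact_eltI.
    by apply/negP => /(point_prime p).2[]; exact/negP.
  by rewrite meetACA meetxx.
- move=> _ [c [kc cp] <-]; apply: contra cp => cab.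
  by apply: le_trans abp; apply/frame_implP; rewrite // meetC.
have xp : x <= point_elt p.
  apply: contrapT => /negP/not_le_compact[c [kc cx cp]].
  have /negP := Dx (c `&` a) (ex_intro2 _ _ c (conj kc cp) erefl); apply.
  by apply: le_trans cx; exact: leIl.
exists (Point px); split=> //; split; last by apply/negP/negPn.
rewrite /opens /= -[a]meet1x; apply: Dx; exists \top => //.
split; first exact: compact_elt1.
by rewrite le1x; have [] := point_prime p.
Qed.

Lemma points_esakia : @esakia_axiom _ (point L).
Proof.
split; [exact: compact_points|exact: points_sep|move=> U [oU clU]].
split; last exact: (@closed_down _ (point L) (@compact_points L) points_sep).
rewrite openE => p [q [Uq pq]].
have [a [b [ka kb abq abU]]] := (open_patch U).1 oU q Uq.
rewrite /interior nbhsE; exists (down (opens a `\` opens b)%classic).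
  split; last by exists q.
  (* The implication is compact because the compact elements form a Heyting subalgebra, so its
     complement is open. *)
  rewrite down_opensD //; rewrite openC; apply: closed_opens.
  exact: compact_impl.
by move=> r [s [/abU Us rs]]; exists s.
Qed.

Definition point_space : esakia_space := EsakiaSpace points_esakia.

Definition opens_upset a : upset_frame point_space :=
  @OpenUpset point_space _ (@open_opens L a) (@upset_opens L a).

(** The witness is the join of the compact [k] with [opens k] inside [U]. These cover [U]: the sets
    [opens k] around a point of [U] exclude every point outside [U], so by compactness one of them
    lies in [U]. *)
Lemma opens_upset_surj (U : upset_frame point_space) : exists a, opens_upset a = U.
Proof.
pose K := [set k : L | compact_elt k /\ opens k `<=` upset_set U].
exists (join_of K); apply/open_upset_inj => /=; rewrite opens_join_of.
apply/seteqP; split=> p; first by move=> [k [_ kU] /kU].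
move=> Up; pose WW :=
  [set opens k | k in [set k | compact_elt k /\ ~~ (k <= point_elt p)]].
have [||||q nUq|_ [k [kk kp] <-] kU] :=
  @compact_avoid (point L) (~` upset_set U)%classic WW.
- apply: closed_compact; first exact: compact_points.
  by rewrite closedC; exact: (upset_open U).
- exists \top; last exact: opens1.
  split; first exact: compact_elt1.
  by rewrite le1x; have [] := point_prime p.
- by move=> _ [k [kk _] <-]; exact: closed_opens.
- move=> _ _ [c [kc cp] <-] [e [ke ep] <-]; exists (c `&` e).
    split; first exact: compact_eltI.
    by apply/negP => /(point_prime p).2[]; exact/negP.
  exact: opensI.
- have /not_le_compact[k [kk kq kp]] : ~~ (point_elt q <= point_elt p).
    by apply/negP => pq; apply: nUq; exact: (@upset_upset _ U p q pq Up).
  by exists (opens k); [exists k|move/negP].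
exists k => //; split=> // x /kU.
by rewrite setCK.
Qed.

Lemma opens_upset_mono : {mono opens_upset : a b / a <= b}.
Proof.
move=> a b; apply/idP/idP => [/open_upset_leP/opens_sub //|ab].
by apply/open_upset_leP; exact/opens_sub.
Qed.

End PointSpace.

(** * Order isomorphisms as morphisms of Heyting frames *)

Section FrameIso.
Variables (L M : heyting_frame) (f : L -> M) (g : M -> L).
Hypotheses (gK : cancel g f) (f_mono : {mono f : a b / a <= b}).

(** An order embedding with a section is an order isomorphism, and least upper bounds are determined
    by the order. *)
Lemma order_iso_join_of (A : set L) : f (join_of A) = join_of (f @` A).
Proof.
apply: (le_join_eq (@hf_frame M)) => [_ [a Aa <-]|c Ac].
  by rewrite f_mono; exact: (join_of_ub (@hf_frame L)).
rewrite -(gK c) f_mono; apply/(join_ofP (@hf_frame L)) => a Aa.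
by rewrite -f_mono gK; apply: Ac; exists a.
Qed.

Lemma order_iso_frame_hom : frame_hom f.
Proof.
split; last exact: order_iso_join_of.
  by apply/le_anti; rewrite lex1 -[X in X <= _]gK f_mono lex1.
move=> a b; apply/le_anti; rewrite lexI !f_mono leIl leIr /=.
by rewrite -[X in X <= _]gK f_mono lexI -!f_mono gK leIl leIr.
Qed.

Lemma order_iso_impl a b : f (frame_impl a b) = frame_impl (f a) (f b).
Proof.
have [_ fI _] := order_iso_frame_hom.
apply/le_anti/andP; split.
  apply/(frame_implP (@hf_frame M)); rewrite -fI f_mono.
  exact/(frame_implP (@hf_frame L)).
rewrite -[X in X <= _]gK f_mono; apply/(frame_implP (@hf_frame L)).
rewrite -f_mono fI gK; exact/(frame_implP (@hf_frame M)).
Qed.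

Lemma order_iso_compact a : compact_elt a -> compact_elt (f a).
Proof.
move=> ka A fA; have [|B [fB BA aB]] := ka (g @` A).
  rewrite -f_mono order_iso_join_of; congr (_ <= join_of _): fA.
  rewrite image_comp -[LHS]image_id; apply: eq_imagel => x _ /=.
  by rewrite gK.
exists (f @` B); split.
- exact: finite_image.
- by move=> _ [b /BA[x Ax <-] <-]; rewrite gK.
- by rewrite -order_iso_join_of f_mono.
Qed.

Definition order_iso_hom : heyting_frame_hom L M :=
  HeytingFrameHom order_iso_frame_hom order_iso_compact order_iso_impl.

End FrameIso.

(** * The unit isomorphism and its inverse *)

Section Unit.
Variable L : heyting_frame.

Definition opens_upset_inv (U : upset_frame (point_space L)) : L :=
  sval (cid (opens_upset_surj U)).

Lemma opens_upset_invK : cancel opens_upset_inv (@opens_upset L).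
Proof. by move=> U; exact: svalP (cid (opens_upset_surj U)). Qed.

Lemma opens_upsetK : cancel (@opens_upset L) opens_upset_inv.
Proof.
move=> a; apply: (@opens_inj L).
by have /(congr1 (@upset_set _)) := opens_upset_invK (opens_upset a).
Qed.

Lemma opens_upset_inv_mono : {mono opens_upset_inv : U V / U <= V}.
Proof. by move=> U V; rewrite -opens_upset_mono !opens_upset_invK. Qed.

Definition unit_hom : heyting_frame_hom L (upset_frame (point_space L)) :=
  order_iso_hom opens_upset_invK (@opens_upset_mono L).

Definition unit_inv_hom : heyting_frame_hom (upset_frame (point_space L)) L :=
  order_iso_hom opens_upsetK opens_upset_inv_mono.

End Unit.

(** * Preimages of down-sets of closures *)

Section DownClosure.
Variables (X Y : esakia_space) (f : X -> Y).
Hypotheses (f_cont : continuous f) (f_homo : {homo f : x y / x <= y}).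

(** Continuity and monotonicity alone give this half, so the morphism condition amounts to the
    reverse inclusion. *)
Lemma down_closure_preimage (E : set Y) :
  down (closure (f @^-1` E)) `<=` f @^-1` down (closure E).
Proof.
move=> x [y [cly xy]]; exists (f y); split; last exact: f_homo.
by move=> A /f_cont Ay; have [z [Ez Az]] := cly _ Ay; exists (f z).
Qed.

(** Closure commutes with finite unions, so a point of [closure E] lies in the closure of one of the
    differences. *)
Lemma E_constructible_down :
  (forall U V : set Y, open U -> upset U -> open V -> upset V ->
    f @^-1` down (closure (U `\` V)%classic)
    `<=` down (closure (f @^-1` (U `\` V)%classic))) ->
  forall E, E_constructible E ->
    f @^-1` down (closure E) = down (closure (f @^-1` E)).
Proof.
move=> fUV E [n [U [V [UV EUV]]]]; apply/seteqP; split; last first.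
  exact: down_closure_preimage.
move=> x [y [clEy fxy]].
have [i cliy] : exists i, closure (U i `\` V i)%classic y.
  have : closed (\bigcup_(i in [set: 'I_n]) closure (U i `\` V i)%classic).
    by apply: closed_bigcup => [|i _]; [exact: finite_finset|exact: closed_closure].
  move=> /closure_id clUV.
  suff [i _ ?] : (\bigcup_(i in [set: 'I_n]) closure (U i `\` V i)%classic) y.
    by exists i.
  rewrite clUV; apply: closureS clEy; rewrite EUV => z [i _ iz].
  by exists i => //; exact: subset_closure.
have [oU uU oV uV] := UV i.
have [|z [clz xz]] := fUV _ _ oU uU oV uV x; first by exists y.
exists z; split=> //; apply: closureS clz => w; rewrite EUV.
by exists i.
Qed.

End DownClosure.

(** * The map of points induced by a frame homomorphism *)

Section PointMap.
Variables (L M : heyting_frame) (f : heyting_frame_hom L M).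
Implicit Types (a b : L) (q : point M).

Lemma heyting_frame_hom_homo : {homo f : a b / a <= b}.
Proof.
have [_ fI _] := hf_fun_frame f.
by move=> a b /meet_idPl <-; rewrite fI; exact: leIr.
Qed.

(** This is the right adjoint of [f] evaluated at [point_elt q]; on completely prime filters it is
    the preimage under [f]. *)
Definition pullback_elt q : L := join_of [set a | f a <= point_elt q].

Lemma le_pullback_elt a q : (a <= pullback_elt q) = (f a <= point_elt q).
Proof.
have [_ _ fJ] := hf_fun_frame f.
apply/idP/idP => [/heyting_frame_hom_homo|faq]; last first.
  exact: (join_of_ub (@hf_frame L)).
move=> /le_trans; apply; rewrite fJ; apply/(join_ofP (@hf_frame M)).
by move=> _ [b bq <-].
Qed.

Fact pullback_prime q : meet_prime (pullback_elt q).
Proof.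
have [f1 fI _] := hf_fun_frame f; have [q1 qI] := point_prime q.
split=> [|a b]; last by rewrite !le_pullback_elt fI => /qI.
apply/eqP => pT; have := le_pullback_elt \top q.
by rewrite pT lexx f1 le1x (negPf q1).
Qed.

Definition point_map q : point L := Point (pullback_prime q).

Lemma point_map_opens a : point_map @^-1` opens a = opens (f a).
Proof. by apply/seteqP; split=> q; rewrite /opens /= le_pullback_elt. Qed.

Lemma point_map_continuous : continuous point_map.
Proof.
apply/continuousP => O /open_patch oO; apply/open_patch => q /oO.
move=> [a [b [ka kb abq abO]]]; exists (f a), (f b).
rewrite -!point_map_opens; split=> //; try exact: hf_fun_compact.
by move=> r /abO.
Qed.

Lemma point_map_homo : {homo point_map : p q / p <= q}.
Proof.
move=> p q pq; change (pullback_elt q <= pullback_elt p).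
rewrite le_pullback_elt; apply: le_trans (pq : point_elt q <= point_elt p).
by rewrite -le_pullback_elt.
Qed.

Lemma point_map_down (E : set (point_space L)) : E_constructible E ->
  point_map @^-1` down (closure E) = down (closure (point_map @^-1` E)).
Proof.
apply: (@E_constructible_down (point_space M) (point_space L)).
- exact: point_map_continuous.
- exact: point_map_homo.
move=> U V oU uU oV uV.
have [a aU] := opens_upset_surj (OpenUpset oU uU : upset_frame (point_space L)).
have [b bV] := opens_upset_surj (OpenUpset oV uV : upset_frame (point_space L)).
have {}aU : U = opens_upset a by rewrite aU.
have {}bV : V = opens_upset b by rewrite bV.
have preD : point_map @^-1` (U `\` V)%classic =
    (opens_upset (f a) `\` opens_upset (f b))%classic.
  by rewrite aU bV /= -!point_map_opens.
(* Both sides become complements of implications of open upsets. The units preserve implication, so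
   the inclusion reduces to preservation of [frame_impl a b] by [f]. *)
rewrite preD aU bV -[down _]setCK -open_upset_impl.
rewrite -[X in _ `<=` X]setCK -open_upset_impl.
have /= <- := hf_fun_impl (unit_hom L) a b.
have /= <- := hf_fun_impl (unit_hom M) (f a) (f b).
by rewrite -hf_fun_impl /= -point_map_opens.
Qed.

Definition point_hom : ES_hom (point_space M) (point_space L) :=
  @ESHom (point_space M) (point_space L) point_map
    point_map_continuous point_map_homo point_map_down.

End PointMap.

(** * The frame homomorphism induced by an Esakia morphism *)

Section UpsetMap.
Variables (X Y : esakia_space) (f : ES_hom X Y).

Fact preimage_upset_subproof (U : open_upset Y) :
  open (f @^-1` U) /\ upset (f @^-1` U).
Proof.
have /continuousP fc := es_fun_continuous (e := f).
split; first by apply: fc; exact: upset_open.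
by move=> x y /(es_fun_homo f); exact: upset_upset.
Qed.

Definition preimage_upset (U : upset_frame Y) : upset_frame X :=
  OpenUpset (preimage_upset_subproof U).1 (preimage_upset_subproof U).2.

Lemma preimage_upset_frame_hom : frame_hom preimage_upset.
Proof.
split=> [|U V|A]; [exact: open_upset_inj|exact: open_upset_inj|].
rewrite !open_upset_join_of; apply: open_upset_inj => /=.
rewrite preimage_bigcup; apply/seteqP; split=> x [].
  by move=> U AU Ux; exists (preimage_upset U) => //; exists U.
by move=> _ [U AU <-] Ux; exists U.
Qed.

Lemma preimage_upset_compact U : compact_elt U -> compact_elt (preimage_upset U).
Proof.
move=> /compact_elt_clopen clU; apply/compact_elt_clopen.
have /continuous_closedP := es_fun_continuous (e := f); exact.
Qed.

Lemma preimage_upset_impl U V : preimage_upset (frame_impl U V) =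
  frame_impl (preimage_upset U) (preimage_upset V).
Proof.
apply: open_upset_inj; rewrite [RHS]open_upset_impl.
rewrite [LHS]/= open_upset_impl preimage_setC; congr setC; apply: es_fun_down.
(* A single difference is E-constructible as a union over one index. *)
exists 1%N, (fun=> upset_set U), (fun=> upset_set V); split=> [_|].
  by split; [exact: upset_open|exact: upset_upset|exact: upset_open|exact: upset_upset].
by apply/seteqP; split=> [x ?|x []//]; exists ord0.
Qed.

Definition preimage_hom : heyting_frame_hom (upset_frame Y) (upset_frame X) :=
  HeytingFrameHom preimage_upset_frame_hom preimage_upset_compact preimage_upset_impl.

End UpsetMap.

(** * The counit: points of the frame of open upsets *)

Section Counit.
Variable X : esakia_space.
Implicit Types x y : X.

Fact open_upset_down1C_subproof x :
  open (~` down [set x])%classic /\ upset (~` down [set x])%classic.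
Proof.
have [cX sepX _] := es_axiom X.
split; last exact: upsetC_down.
rewrite openC; apply: closed_down => //; apply: compact_closed.
  exact: priestley_hausdorff.
exact: compact_set1.
Qed.

Definition not_below x : upset_frame X := OpenUpset
  (open_upset_down1C_subproof x).1 (open_upset_down1C_subproof x).2.

(** Hence the completely prime filter encoded by [not_below x] is that of the open upsets containing
    [x], which makes primeness immediate. *)
Lemma not_belowP x (U : upset_frame X) : U <= not_below x <-> ~ upset_set U x.
Proof.
split=> [/open_upset_leP Ux xU|nUx].
  by apply: (Ux x xU); exists x.
apply/open_upset_leP => y Uy [_ [-> yx]]; apply: nUx.
exact: upset_upset yx Uy.
Qed.

Fact not_below_prime x : meet_prime (not_below x).
Proof.
split=> [|U V /not_belowP UV].
  by apply/eqP => xT; have /not_belowP := lexx (not_below x); rewrite {1}xT; exact.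
have [Ux|nUx] := pselect (upset_set U x); last by left; exact/not_belowP.
by right; apply/not_belowP => Vx; exact: UV.
Qed.

Definition point_of x : point (upset_frame X) := Point (not_below_prime x).

Lemma point_of_mono : {mono point_of : x y / x <= y}.
Proof.
move=> x y; apply/idP/idP => [xy|xy].
  have /not_belowP : not_below y <= not_below x by [].
  by move=> /contrapT [_ [->]].
by apply/not_belowP; apply; exists y.
Qed.

(** The complement of the prime [P] has a greatest element, which is the required [x]. Otherwise the
    clopen upsets not inside [P], closed under intersection by primeness, would exclude every point
    outside [P]; by compactness one of them would lie in [P]. *)
Lemma point_of_surj p : exists x, point_of x = p.
Proof.
have [cX sepX _] := es_axiom X; have [p1 pI] := point_prime p.
pose P : open_upset X := point_elt p.
have [x [nPx xP]] : exists x, ~ upset_set P x /\ forall y, ~ upset_set P y -> y <= x.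
  apply: contrapT => none.
  pose WW := [set W : set X | [/\ clopen W, upset W & ~ W `<=` P]].
  have [||||y nPy|W [_ _ nWP] WP] := @compact_avoid X (~` P)%classic WW.
  - by apply: closed_compact => //; rewrite closedC; exact: upset_open.
  - split=> //; first exact: clopenT.
    move=> TP; case/eqP: p1; apply: open_upset_inj; exact/seteqP.
  - by move=> W [[]].
  - move=> W W' [[oW clW] uW nWP] [[oW' clW'] uW' nWP']; split.
    + by split; [exact: openI|exact: closedI].
    + exact: upsetI.
    + move=> WWP; have [|/open_upset_leP //|/open_upset_leP //] :=
        pI (OpenUpset oW uW) (OpenUpset oW' uW').
      exact/open_upset_leP.
  - apply: contrapT => none'; apply: none; exists y; split=> // z nPz.
    apply: contrapT => /negP/sepX[U [cU uU Uz nUy]].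
    by apply: none'; exists U => //; split=> // UP; exact/nPz/UP.
  by apply: nWP => y /WP; rewrite setCK.
exists x; apply: point_inj; apply: open_upset_inj; apply/seteqP; split=> y /=.
  by move=> nyx; apply: contrapT => /xP yx; apply: nyx; exists x.
by move=> Py [_ [-> yx]]; apply: nPx; exact: upset_upset yx Py.
Qed.

Definition point_of_inv p : X := sval (cid (point_of_surj p)).

Lemma point_of_invK : cancel point_of_inv point_of.
Proof. by move=> p; exact: svalP (cid (point_of_surj p)). Qed.

Lemma point_ofK : cancel point_of point_of_inv.
Proof.
move=> x; apply/le_anti.
by rewrite -!point_of_mono point_of_invK lexx.
Qed.

Lemma point_of_opens (U : upset_frame X) : point_of @^-1` opens U = upset_set U.
Proof.
apply/seteqP; split=> x.
  by move=> /negP nUx; apply: contrapT => /not_belowP.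
by move=> Ux; apply/negP => /not_belowP.
Qed.

Lemma point_of_continuous : continuous point_of.
Proof.
apply/continuousP => O /open_patch oO; rewrite openE => x /oO.
move=> [U [V [/compact_elt_clopen clU /compact_elt_clopen clV UVx UVO]]].
rewrite /interior nbhsE; exists (U `\` V)%classic => [|y Uy].
  split; last by rewrite -[upset_set U]point_of_opens -[upset_set V]point_of_opens.
  by apply: openI; [exact: upset_open|rewrite openC].
apply: UVO; move: Uy.
by rewrite -[upset_set U]point_of_opens -[upset_set V]point_of_opens.
Qed.

(** A continuous bijection from a compact space to a Hausdorff space is a closed map. *)
Lemma point_of_inv_continuous : continuous point_of_inv.
Proof.
have [cX sepX _] := es_axiom X.
apply/continuous_closedP => C clC.
have -> : point_of_inv @^-1` C = point_of @` C.
  apply/seteqP; split=> [p Cp|_ [x Cx <-]]; last by rewrite /= point_ofK.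
  by exists (point_of_inv p) => //; exact: point_of_invK.
apply: compact_closed.
  exact: (priestley_hausdorff (@points_sep _)).
apply: continuous_compact; last exact: closed_compact.
exact/continuous_subspaceT/point_of_continuous.
Qed.

End Counit.

(** * Order homeomorphisms as Esakia morphisms *)

Section EsakiaIso.
Variables (X Y : esakia_space) (f : X -> Y) (g : Y -> X).
Hypotheses (fK : cancel f g) (gK : cancel g f).
Hypotheses (f_cont : continuous f) (g_cont : continuous g).
Hypotheses (f_mono : {mono f : x y / x <= y}).

Lemma homeo_down E : E_constructible E ->
  f @^-1` down (closure E) = down (closure (f @^-1` E)).
Proof.
move=> _; apply/seteqP; split; last first.
  by apply: down_closure_preimage => // x y; rewrite f_mono.
move=> x [y [clEy fxy]]; exists (g y); split; last by rewrite -f_mono gK.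
move=> A /g_cont gA; have [z [Ez Az]] := clEy _ gA; exists (g z).
by split=> //=; rewrite gK.
Qed.

Lemma homeo_homo : {homo f : x y / x <= y}.
Proof. by move=> x y; rewrite f_mono. Qed.

Definition homeo_hom : ES_hom X Y := ESHom f_cont homeo_homo homeo_down.

End EsakiaIso.

Section CounitHom.
Variable X : esakia_space.

Definition point_of_hom : ES_hom X (point_space (upset_frame X)) :=
  @homeo_hom X (point_space (upset_frame X)) _ _ (@point_of_invK X)
    (@point_of_continuous X) (@point_of_inv_continuous X) (@point_of_mono X).

Lemma point_of_inv_mono : {mono @point_of_inv X : p q / p <= q}.
Proof. by move=> p q; rewrite -point_of_mono !point_of_invK. Qed.

Definition point_of_inv_hom : ES_hom (point_space (upset_frame X)) X :=
  @homeo_hom (point_space (upset_frame X)) X _ _ (@point_ofK X)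
    (@point_of_inv_continuous X) (@point_of_continuous X) point_of_inv_mono.

End CounitHom.

(** Naturality of [point_of]: an open upset lies below either prime exactly when it misses [f x]. *)
Lemma point_map_point_of (X Y : esakia_space) (f : ES_hom X Y) (x : X) :
  point_map (preimage_hom f) (point_of x) = point_of (f x).
Proof.
apply: point_inj; apply/le_anti/andP; split.
  apply/not_belowP => fx.
  have : pullback_elt (preimage_hom f) (point_of x)
      <= pullback_elt (preimage_hom f) (point_of x) by [].
  by rewrite le_pullback_elt => /not_belowP; apply.
have := le_pullback_elt (preimage_hom f) (not_below (f x)) (point_of x).
move=> /= ->; apply/not_belowP; apply.
by exists (f x).
Qed.

(** * The two functors and the dual equivalence *)

Lemma point_hom1 (L : heyting_frame) :
  point_hom (heyting_frame_id L) = ES_id (point_space L).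
Proof.
apply: ES_hom_ext => p; apply: point_inj; apply/esym.
apply: (le_join_eq (@hf_frame L)) => // c pc.
exact/pc/lexx.
Qed.

Lemma point_homM (L M N : heyting_frame) (g : heyting_frame_hom M N)
    (f : heyting_frame_hom L M) :
  point_hom (heyting_frame_comp g f) = ES_comp (point_hom f) (point_hom g).
Proof.
apply: ES_hom_ext => p; apply: point_inj => /=; congr join_of.
by apply/seteqP; split=> a; rewrite /= le_pullback_elt.
Qed.

Definition point_functor : functor (opposite HeytFrm_plus) ES_plus :=
  @Functor (opposite HeytFrm_plus) ES_plus point_space
    (fun _ _ f => point_hom f) point_hom1 (fun _ _ _ g f => point_homM f g).

Lemma preimage_hom1 (X : esakia_space) :
  preimage_hom (ES_id X) = heyting_frame_id (upset_frame X).
Proof. by apply: heyting_frame_hom_ext => U; exact: open_upset_inj. Qed.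

Lemma preimage_homM (X Y Z : esakia_space) (g : ES_hom Y Z) (f : ES_hom X Y) :
  preimage_hom (ES_comp g f) = heyting_frame_comp (preimage_hom f) (preimage_hom g).
Proof. by apply: heyting_frame_hom_ext => U; exact: open_upset_inj. Qed.

Definition upset_functor : functor ES_plus (opposite HeytFrm_plus) :=
  @Functor ES_plus (opposite HeytFrm_plus) upset_frame
    (fun _ _ f => preimage_hom f) preimage_hom1 (fun _ _ _ g f => preimage_homM g f).

Theorem theorem3p16 : dually_equivalent HeytFrm_plus ES_plus.
Proof.
exists point_functor, upset_functor; split.
  (* A component from the composite to the identity in the opposite category is a frame homomorphism
     out of [L], hence the unit itself. *)
  exists unit_hom; split=> [L M f|L].
    apply: heyting_frame_hom_ext => a; apply: open_upset_inj.
    exact: point_map_opens.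
  exists (unit_inv_hom L); split; apply: heyting_frame_hom_ext => x.
    exact: opens_upset_invK.
  exact: opens_upsetK.
(* Here the arrows are not reversed, so the component is the inverse of [point_of]; its naturality
   follows by applying the injective [point_of]. *)
exists point_of_inv_hom; split=> [X Y f|X].
  apply: ES_hom_ext => p; apply: (can_inj (@point_ofK Y)) => /=.
  by rewrite point_of_invK -point_map_point_of point_of_invK.
exists (point_of_hom X); split; apply: ES_hom_ext => x.
  exact: point_of_invK.
exact: point_ofK.
Qed.
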